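(* Let $w$ be a word over $A$ with $|w|\ge 2$ and let $w=ps$ where $s$ is the longest Nyldon proper suffix of $w$ (the longest Nyldon word $s\ne w$ that is a suffix of $w$). Then $w$ is Nyldon if and only if $p$ is Nyldon and $p>_{\mathrm{lex}}s$.
   Context: $A$ is a finite alphabet of cardinality at least $2$ with a total order $<$. $A^*$ is the set of finite words over $A$ (including the empty word $\varepsilon$), $|w|$ is the length of $w$. The lexicographic order $<_{\mathrm{lex}}$ on $A^*$ is the total order given by: $u<_{\mathrm{lex}}v$ if $u$ is a proper prefix of $v$, or there exist letters $i<j$ and a word $p$ such that $pi$ is a prefix of $u$ and $pj$ is a prefix of $v$; $u\le_{\mathrm{lex}}v$ means $u<_{\mathrm{lex}}v$ or $u=v$. Nyldon words are defined recursively on length: every letter (word of length $1$) is Nyldon; a word $w$ of length at least $2$ is Nyldon if and only if there is no sequence $(n_1,\ldots,n_k)$ of Nyldon words with $w=n_1\cdots n_k$, $\max\{|n_1|,\ldots,|n_k|\}<|w|$ and $n_1\le_{\mathrm{lex}}\cdots\le_{\mathrm{lex}}n_k$. The empty word is not Nyldon. *)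

(* Defs.v *)
From mathcomp Require Import all_boot all_order.

Set Implicit Arguments.
Unset Strict Implicit.
Unset Printing Implicit Defensive.

Import Order.TTheory.

Section Nyldon.
Context {d : Order.disp_t} {A : finOrderType d}.
Implicit Types (u v w s t : seq A) (ns : seq (seq A)).

Definition lex_le u v : bool := (u <= v :> seqlexi A)%O.
Definition lex_lt u v : bool := (u < v :> seqlexi A)%O.

Lemma lex_leE u v : lex_le u v = lex_lt u v || (u == v).
Proof. by rewrite /lex_le /lex_lt le_eqVlt orbC. Qed.

(* The library order is the usual one: a proper prefix is smaller, otherwise
   the first differing letter decides. *)
Lemma lex_ltP u v :
  lex_lt u v <->
    (prefix u v /\ u <> v) \/
    (exists i j p, [/\ (i < j)%O, prefix (rcons p i) u & prefix (rcons p j) v]).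
Proof.
rewrite /lex_lt; elim: u v => [|x u IH] [|y v] /=.
- by split=> // -[[_ []] //|[i [j [[|z p] [_ //]]]]].
- by rewrite ltxi0s; split=> // _; left.
- rewrite ltxis0; split=> // -[[//]|[i [j [[|z p] [_ _ //]]]]].
rewrite ltxi_cons; case: (ltgtP x y) => [xy|yx|->] /=.
- split=> // _; right; exists x, y, [::].
  by rewrite /= !eqxx !prefix0s.
- split=> // -[[//]|[i [j [[|z p] [ij]]]]] /=.
  + move=> /andP[/eqP ei _] /andP[/eqP ej _].
    by move: ij; rewrite ei ej lt_gtF.
  + move=> /andP[/eqP ex _] /andP[/eqP ey _].
    by rewrite -ex -ey ltxx in yx.
apply: (iff_trans (IH v)); split=> [[[puv nuv]|[i [j [p [ij pu pv]]]]]|].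
- by left; split=> // -[].
- by right; exists i, j, (y :: p); rewrite /= eqxx.
case=> [[puv nuv]|[i [j [[|z p] [ij]]]]] /=.
- by left; split=> // e; apply: nuv; rewrite e.
- move=> /andP[/eqP ei _] /andP[/eqP ej _].
  by rewrite ei ej ltxx in ij.
- by move=> /andP[_ pu] /andP[_ pv]; right; exists i, j, p.
Qed.

(* [n] is fuel for the recursion on length; see [nyldonE]. *)
Fixpoint nyldon_fuel (n : nat) (w : seq A) : Prop :=
  if n is m.+1 then
    size w = 1 \/
    2 <= size w /\
    ~ (exists ns, [/\ flatten ns = w,
                      forall u, u \in ns -> nyldon_fuel m u,
                      forall u, u \in ns -> size u < size w
                    & sorted lex_le ns])
  else False.

Definition nyldon (w : seq A) : Prop := nyldon_fuel (size w) w.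

Lemma nyldon_fuel_enough n m w :
  size w <= n -> size w <= m -> nyldon_fuel n w <-> nyldon_fuel m w.
Proof.
elim: n m w => [|n IH] [|m] w //=.
- by rewrite leqn0 => /eqP-> _; split=> // -[|[]].
- by rewrite leqn0 => _ /eqP->; split=> // -[|[]].
move=> wn wm.
have H u : size u < size w -> nyldon_fuel n u <-> nyldon_fuel m u.
  by move=> uw; apply: IH; rewrite -ltnS; apply: leq_trans uw _.
by split=> -[|[w2 nex]]; [left|right; split=> // -[ns [fl ny sz so]]; apply: nex;
   exists ns; split=> // u uns; apply/(H u (sz u uns)); apply: ny
  |left|right; split=> // -[ns [fl ny sz so]]; apply: nex;
   exists ns; split=> // u uns; apply/(H u (sz u uns)); apply: ny].
Qed.

Lemma nyldonE w :
  nyldon w <->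
    size w = 1 \/
    2 <= size w /\
    ~ (exists ns, [/\ flatten ns = w,
                      forall u, u \in ns -> nyldon u,
                      forall u, u \in ns -> size u < size w
                    & sorted lex_le ns]).
Proof.
apply: (iff_trans (@nyldon_fuel_enough _ (size w).+1 w _ _)) => //=.
have H u : size u < size w ->
    nyldon_fuel (size w) u <-> nyldon_fuel (size u) u.
  by move=> uw; apply: nyldon_fuel_enough => //; apply: ltnW.
by split=> -[|[w2 nex]]; [left|right; split=> // -[ns [fl ny sz so]]; apply: nex;
   exists ns; split=> // u uns; apply/(H u (sz u uns)); apply: ny
  |left|right; split=> // -[ns [fl ny sz so]]; apply: nex;
   exists ns; split=> // u uns; apply/(H u (sz u uns)); apply: ny].
Qed.

Definition nyldon_proper_suffix (s w : seq A) : Prop :=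
  [/\ nyldon s, s <> w & suffix s w].

Definition longest_nyldon_proper_suffix (s w : seq A) : Prop :=
  nyldon_proper_suffix s w /\
  forall t, nyldon_proper_suffix t w -> size t <= size s.

End Nyldon.

(* Main.v *)
Require Import Defs.
From mathcomp Require Import all_boot all_order.
From Stdlib Require Import Classical.

(** The theorem is a consequence of one fact: in a nondecreasing factorization
    of a word into Nyldon words, the last factor is the longest Nyldon suffix
    of the word ([nyldon_suffix_le_last]).

    Granting it, let [w = p ++ s] as in the theorem.  If [p] is Nyldon, [s < p]
    and [w] is not Nyldon, then [w] has a nondecreasing factorization, whose
    last factor must be [s]; the other factors then factor the Nyldon word [p],
    so there is only one of them, [p] itself, and [p <= s], a contradiction.
    Conversely let [w] be Nyldon and let [x] be the last factor of a
    nondecreasing factorization of [p].  If [x <= s], then appending [s] gives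
    a nontrivial factorization of [w], which a Nyldon word does not have; so
    [s < x].  By the direction just proved,
    [x ++ s] is Nyldon, and the maximality of [s] forces [x ++ s = w], that is
    [x = p].

    The fact about the last factor holds when every factor exceeds all its Nyldon
    proper suffixes.  Indeed, a Nyldon suffix longer than the last factor
    starts inside some earlier factor [x], with a nonempty suffix [y] of [x].
    The last term of a factorization of [y] is then at most [x], hence at most
    the factor after [x], so this factorization extends by the factors after
    [x] to a nontrivial nondecreasing factorization of a Nyldon word.

    That Nyldon words exceed their Nyldon proper suffixes
    ([nyldon_gt_suffixes]) is proved by induction on the length: below the
    length of [w] it yields the theorem for [w] itself, hence
    [s < p < p ++ s = w] for the longest Nyldon proper suffix [s], and the
    shorter ones are Nyldon proper suffixes of [s]. *)

Set Implicit Arguments.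
Unset Strict Implicit.
Unset Printing Implicit Defensive.

Import Order.TTheory.

(** * Suffixes and the lexicographic order *)

Lemma suffix_of_longer (T : eqType) (s t w : seq T) :
  suffix s w -> suffix t w -> size t <= size s -> suffix t s.
Proof.
case/suffixP=> q ->; rewrite !suffixE size_cat => /eqP tE ts.
by rewrite -[X in _ == X]tE drop_cat -addnBA // ltnNge leq_addr addKn.
Qed.

Lemma suffix_anti (T : eqType) (s t : seq T) :
  suffix s t -> suffix t s -> s = t.
Proof.
move=> st ts; have /eqP szE : size s == size t.
  by rewrite eqn_leq !size_suffix.
by move: st; rewrite suffixE szE subnn drop0 => /eqP.
Qed.

Lemma cats_inj (T : eqType) (s t u : seq T) : s ++ u = t ++ u -> s = t.
Proof.
move=> e; have /eqP := e; rewrite eqseq_cat; first by case/andP=> /eqP.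
by have := congr1 size e; rewrite !size_cat => /addIn.
Qed.

Section NyldonFactorization.
Context {d : Order.disp_t} {A : finOrderType d}.
Implicit Types (p s t u v w x y : seq A) (ms ns : seq (seq A)).

Lemma lex_lt_trans u v w : lex_lt u v -> lex_lt v w -> lex_lt u w.
Proof. exact: lt_trans. Qed.

Lemma lex_ltNge u v : lex_lt u v = ~~ lex_le v u.
Proof. exact: ltNge. Qed.

Lemma lex_lt_cat p s : s != [::] -> lex_lt p (p ++ s).
Proof.
move=> s0; apply/lex_ltP; left; split; first exact: prefix_prefix.
by move=> /(congr1 size)/eqP; rewrite size_cat -[X in X == _]addn0 eqn_add2l
  eq_sym size_eq0 (negPf s0).
Qed.

(** * Nondecreasing factorizations into Nyldon words *)

Definition nyldon_fact ns w : Prop :=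
  [/\ flatten ns = w, forall u, u \in ns -> nyldon u & sorted lex_le ns].

Lemma nyldon_size_gt0 w : nyldon w -> 0 < size w.
Proof. by move/nyldonE=> [->|[/ltnW]]. Qed.

(** All the factors but [u] contribute at least one letter each. *)
Lemma size_factor ns u :
  (forall v, v \in ns -> nyldon v) -> u \in ns ->
  size u + size ns <= (size (flatten ns)).+1.
Proof.
have count ms : (forall v, v \in ms -> nyldon v) -> size ms <= size (flatten ms).
  elim: ms => //= y ms IH ny; rewrite size_cat -add1n leq_add //.
    by apply/nyldon_size_gt0/ny/mem_head.
  by apply: IH => v vm; apply: ny; rewrite inE vm orbT.
elim: ns => //= y ns IH ny; rewrite inE size_cat.
have nyns v : v \in ns -> nyldon v by move=> vn; apply: ny; rewrite inE vn orbT.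
case/predU1P=> [->|un]; first by rewrite addnS ltnS leq_add2l count.
rewrite addnS ltnS (leq_trans (IH nyns un)) // -add1n leq_add2r.
by apply/nyldon_size_gt0/ny/mem_head.
Qed.

(** The definition excludes only factorizations into factors shorter than [w];
    two or more factors are always shorter, since Nyldon words are nonempty. *)
Lemma nyldon_fact_trivial ns w : nyldon w -> nyldon_fact ns w -> ns = [:: w].
Proof.
move=> nyw [fl ny so]; case: ns fl ny so => [|x [|y ns]].
- by move=> w0; move: (nyldon_size_gt0 nyw); rewrite -w0.
- by rewrite /= cats0 => ->.
move=> fl ny so.
have lt u : u \in [:: x, y & ns] -> size u < size w.
  move=> /(size_factor ny); rewrite fl /= !addnS ltnS.
  by apply: leq_trans; rewrite ltnS leq_addr.
case/nyldonE: (nyw) => [w1|[_ []]]; last by exists [:: x, y & ns].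
have := lt x (mem_head _ _).
by rewrite w1 ltnNge (nyldon_size_gt0 (ny x (mem_head _ _))).
Qed.

Lemma nyldon_fact_exists w : exists ns, nyldon_fact ns w.
Proof.
case: (classic (nyldon w)) => [nyw|nw].
  exists [:: w]; split=> //=; first exact: cats0.
  by move=> u; rewrite inE => /eqP->.
case: (leqP 2 (size w)) => [w2|].
  apply: NNPP => nex; apply/nw/nyldonE; right; split=> // -[ns [fl ny _ so]].
  by apply: nex; exists ns.
case: w nw => [|a [|b w]] // nw; first by exists [::].
by case: nw; apply/nyldonE; left.
Qed.

Definition gt_nyldon_suffixes w : Prop :=
  forall t, nyldon_proper_suffix t w -> lex_lt t w.

(** A nonempty suffix [y] of [x] ends with a Nyldon word that cannot exceed [x];
    this is what allows a factor of a factorization to be cut. *)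
Lemma nyldon_fact_suffix x y :
    nyldon x -> gt_nyldon_suffixes x -> suffix y x -> y != [::] ->
  exists ms z, nyldon_fact (rcons ms z) y /\ lex_le z x.
Proof.
move=> nx gx yx y0; have [ns] := nyldon_fact_exists y.
case/lastP: ns => [[fl _ _]|ms z [fl ny so]]; first by rewrite -fl in y0.
exists ms, z; split=> //; rewrite lex_leE orbC.
case: eqVneq => //= zx; apply: gx; split; [|exact/eqP|].
  by apply: ny; rewrite mem_rcons mem_head.
by apply: suffix_trans yx; rewrite -fl flatten_rcons suffix_suffix.
Qed.

(** Together with the last factor being itself a Nyldon suffix, this makes it the
    longest one; the comparison with suffixes is assumed of the factors only, so
    that the lemma can be used while that comparison is still being proved. *)
Lemma nyldon_suffix_le_last ns t :
    (forall u, u \in ns -> nyldon u) -> sorted lex_le ns ->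
    (forall u, u \in ns -> gt_nyldon_suffixes u) ->
    nyldon t -> suffix t (flatten ns) ->
  size t <= size (last [::] ns).
Proof.
move=> ny so gt nt; elim: ns ny so gt => [|x [|z ns] IH] ny so gt.
- by move/size_suffix.
- by rewrite /= cats0 => /size_suffix.
set ns' := z :: ns in IH ny so gt *.
have nx := ny x (mem_head _ _); have gx := gt x (mem_head _ _).
have tl u : u \in ns' -> u \in x :: ns' by move=> un; rewrite inE un orbT.
have /andP[xz so'] : lex_le x z && sorted lex_le ns' by [].
move=> tw; case: (leqP (size t) (size (flatten ns'))) => szt.
  apply: IH => // [u /tl/ny|u /tl/gt|] //.
  by apply: (suffix_of_longer _ tw szt); exact: (suffix_suffix x).
(* Otherwise [t] starts inside [x] (possibly at its first letter); cutting [x]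
   there yields a factorization of [t] with at least two factors. *)
have /suffixP[y ty] : suffix (flatten ns') t.
  by apply: suffix_of_longer tw _ (ltnW szt); exact: (suffix_suffix x).
have y0 : y != [::] by apply: contraTneq szt => y0; rewrite ty y0 ltnn.
have yx : suffix y x.
  case/suffixP: tw => q; rewrite ty catA => /(@cats_inj _ x) ->.
  exact: suffix_suffix.
have [ms [m [[fl nm sm] mx]]] := nyldon_fact_suffix nx gx yx y0.
have /(nyldon_fact_trivial nt)/(congr1 size)/eqP : nyldon_fact (rcons ms m ++ ns') t.
  split; first by rewrite flatten_cat fl ty.
    by move=> u; rewrite mem_cat => /orP[/nm|/tl/ny].
  rewrite cat_rcons; case: (ms) sm => [|m' ms'] /=.
    by rewrite -/(sorted lex_le ns') => _; apply/andP; split=> //; apply: le_trans mx xz.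
  rewrite rcons_path cat_path /= => /andP[-> ->] /=.
  by apply/andP; split=> //; apply: le_trans mx xz.
by rewrite size_cat size_rcons /= addnS.
Qed.

(** * The criterion, given the comparison with suffixes for shorter words *)

(** The bound [n] serves the induction of [nyldon_gt_suffixes]: a nontrivial
    factorization of a word of length at most [n] has factors of length below
    [n], to which [gt_below] applies. *)
Section Criterion.
Context (n : nat).
Context (gt_below : forall u, size u < n -> nyldon u -> gt_nyldon_suffixes u).

(** Were [w] not Nyldon, the last factor of a factorization of [w] would be its
    longest Nyldon suffix [s], so the factorization would be [p; s] with
    [p <= s]. *)
Lemma nyldon_cat w p s :
    size w <= n -> w = p ++ s -> longest_nyldon_proper_suffix s w ->
  nyldon p -> lex_lt s p -> nyldon w.
Proof.
move=> wn wps [[ns sw suf] longest] np sp; apply: NNPP => nw.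
have [ms] := nyldon_fact_exists w; case/lastP: ms => [[fl _ _]|ms x [fl ny so]].
  by move: wps (nyldon_size_gt0 np); rewrite -fl; case: (p).
have xm : x \in rcons ms x by rewrite mem_rcons mem_head.
have xw : suffix x w by rewrite -fl flatten_rcons suffix_suffix.
have nx := ny x xm.
have ms0 : 0 < size ms.
  by case: (ms) fl => //= xE; case: nw; rewrite -xE cats0.
have small u : u \in rcons ms x -> size u < n.
  move=> /(size_factor ny); rewrite fl size_rcons addnS ltnS => le.
  by apply: leq_trans wn; apply: leq_trans le; rewrite -addn1 leq_add2l.
have := nyldon_suffix_le_last ny so (fun u um => gt_below (small u um) (ny u um)) ns.
rewrite fl last_rcons => /(_ suf) sx.
have xs : size x <= size s.
  by apply: longest; split=> // xE; apply: nw; rewrite -xE.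
have xsE : x = s.
  apply: suffix_anti.
    exact: suffix_of_longer suf xw xs.
  exact: suffix_of_longer xw suf sx.
have flp : flatten ms = p.
  by apply: (@cats_inj _ _ _ s); rewrite -wps -[X in _ ++ X]xsE -flatten_rcons.
have mp : ms = [:: p].
  apply: nyldon_fact_trivial => //; split=> // [u um|].
    by apply: ny; rewrite mem_rcons inE um orbT.
  by move: so; rewrite -cats1 => /cat_sorted2[].
by move: so sp; rewrite mp xsE /= andbT lex_ltNge => ->.
Qed.

(** For the direct implication, let [x] be the last factor of [p]: [x ++ s] is
    Nyldon by [nyldon_cat], as its longest Nyldon proper suffix is still [s], so
    by the maximality of [s] it cannot be a proper suffix of [w]. *)
Lemma nyldon_cat_iff w p s :
    size w <= n -> w = p ++ s -> longest_nyldon_proper_suffix s w ->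
  nyldon w <-> nyldon p /\ lex_lt s p.
Proof.
move=> wn wps ls; split=> [nw|[]]; last exact: nyldon_cat wn wps ls.
have [[ns sw suf] longest] := ls.
have p0 : p != [::] by apply/eqP => p0; apply: sw; rewrite wps p0.
have [ms] := nyldon_fact_exists p; case/lastP: ms => [[fl _ _]|ms x [fl ny so]].
  by rewrite -fl in p0.
have nx : nyldon x by apply: ny; rewrite mem_rcons mem_head.
have sx : lex_lt s x.
  rewrite lex_ltNge; apply/negP => xs.
  have /(nyldon_fact_trivial nw)/(congr1 size)/eqP :
      nyldon_fact (rcons (rcons ms x) s) w.
    split; first by rewrite flatten_rcons fl.
      by move=> u; rewrite mem_rcons inE => /predU1P[->|/ny].
    case: (ms) so => [|m ms'] /=; first by rewrite andbT.
    by rewrite !rcons_path last_rcons => ->.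
  by rewrite !size_rcons.
have xsw : suffix (x ++ s) w.
  by rewrite wps -fl flatten_rcons -catA suffix_suffix.
have lt : size s < size (x ++ s).
  by rewrite size_cat -add1n leq_add2r nyldon_size_gt0.
have nxs : nyldon (x ++ s).
  apply: (@nyldon_cat _ x s) => //; first exact: leq_trans (size_suffix xsw) wn.
  split; first by split=> //; [move=> e; rewrite -e ltnn in lt|exact: suffix_suffix].
  move=> t [nt tne txs]; apply: longest; split=> //; last exact: suffix_trans xsw.
  by move=> tw; apply: tne; apply: suffix_anti; rewrite // tw.
have xsE : x ++ s = w.
  by apply: NNPP => ne; have := longest _ (And3 nxs ne xsw); rewrite leqNgt lt.
suff <- : x = p by [].
by apply: (@cats_inj _ _ _ s); rewrite xsE.
Qed.
End Criterion.

(** * Nyldon words exceed their Nyldon proper suffixes *)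

Lemma longest_nyldon_proper_suffix_exists t w :
  nyldon_proper_suffix t w ->
  exists s, longest_nyldon_proper_suffix s w /\ size t <= size s.
Proof.
have [k] := ubnP (size w - size t); elim: k t => // k IH t; rewrite ltnS => kt tw.
case: (classic (longest_nyldon_proper_suffix t w)) => [lt|nlt]; first by exists t.
have [t' [t'w tt']] : exists t', nyldon_proper_suffix t' w /\ size t < size t'.
  apply: NNPP => nex; apply: nlt; split=> // t' t'w; rewrite leqNgt.
  by apply/negP => lt; apply: nex; exists t'.
have [|s [ls ts]] := IH t' _ t'w; last first.
  by exists s; split=> //; apply: leq_trans (ltnW tt') ts.
have [_ _ /size_suffix t'le] := t'w.
by apply: leq_trans kt; apply: ltn_sub2l => //; apply: leq_trans t'le.
Qed.

(** The longest Nyldon proper suffix [s] of [w = p ++ s] satisfies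
    [s < p < p ++ s] by the criterion; a shorter one is a Nyldon proper suffix
    of [s], hence below [s] by induction. *)
Lemma nyldon_gt_suffixes w : nyldon w -> gt_nyldon_suffixes w.
Proof.
have [n] := ubnP (size w); elim: n w => // n IH w; rewrite ltnS => wn nw t tw.
have [s [ls ts]] := longest_nyldon_proper_suffix_exists tw.
have [[ns sw suf] _] := ls; case/suffixP: (suf) => p wps.
have [np sp] := (nyldon_cat_iff IH wn wps ls).1 nw.
have s0 : s != [::] by rewrite -size_eq0 -lt0n nyldon_size_gt0.
have lt_sw : lex_lt s w.
  by rewrite [X in lex_lt _ X]wps; apply: lex_lt_trans sp _; apply: lex_lt_cat.
have [-> //|tns] := eqVneq t s.
apply: lex_lt_trans lt_sw; apply: IH ns _ _ => //.
  apply: leq_trans wn; rewrite wps size_cat -add1n leq_add2r.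
  exact: nyldon_size_gt0.
by have [nt _ tsw] := tw; split=> //; [apply/eqP|apply: suffix_of_longer tsw ts].
Qed.

End NyldonFactorization.

Theorem theorem20 (d : Order.disp_t) (A : finOrderType d) (hA : 2 <= #|A|)
    (w p s : seq A) (hw : 2 <= size w) (hps : w = p ++ s)
    (hs : longest_nyldon_proper_suffix s w) :
  nyldon w <-> nyldon p /\ lex_lt s p.
Proof.
by apply: nyldon_cat_iff (leqnn _) hps hs => u _; apply: nyldon_gt_suffixes.
Qed.
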